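(* Let $C_m$ be a Hermitian code with $q^2-q-1\le m\le 2q^2-2q-3$ and $m<\widetilde m$, so that $\widetilde\delta_m=\mu q=w(x^\mu)$. An $\mathbb{F}_{q^2}$-divisor $D$ over the Hermitian curve $\mathcal{H}$ is the support of minimum-weight codewords of $C_m$ if and only if it is a complete intersection of either of the following types: (i) $D=\mathcal{H}\cap\mathcal{X}$ with $\mathcal{X}$ the curve defined by a polynomial $F$ such that $\mathrm{LM}_\prec(F)=x^\mu$; (ii) $m=(\mu+q-3)(q+1)+1$ with $1\le\mu\le q-1$, and $D=\mathcal{X}\cap\mathcal{Y}$ with $\mathcal{X}$, $\mathcal{Y}$ curves defined by polynomials $F_1$ and $F_2$ such that $\mathrm{LM}_\prec(F_1)=x^q$ and $\mathrm{LM}_\prec(F_2)=y^\mu$.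
   Context: $q$ is a power of a prime, $A=\mathbb{F}_{q^2}[x,y]$, and $\mathcal{H}$ is the affine Hermitian curve defined by $H=x^{q+1}-y^q-y$. It has exactly $n=q^3$ points $P_1,\dots,P_n$ with coordinates in $\mathbb{F}_{q^2}$; $E=\{P_1,\dots,P_n\}$ and $A_E=A/\langle H,x^{q^2}-x,y^{q^2}-y\rangle$. An $\mathbb{F}_{q^2}$-divisor over $\mathcal{H}$ is a subset $D\subseteq E$ (a sum of pairwise distinct $\mathbb{F}_{q^2}$-points of $\mathcal{H}$), and $I_D\subseteq A$ is the ideal of polynomials vanishing on $D$. Weights: $w(x^ry^s)=rq+s(q+1)$. $V_m\subseteq A_E$ is the span of the classes of monomials of weight $w\le m$, and the Hermitian code $C_m\subseteq(\mathbb{F}_{q^2})^n$ is the dual code of $\{(f(P_1),\dots,f(P_n)) : f\in V_m\}$. The support of a codeword $(c_1,\dots,c_n)$ is identified with the set of points $\{P_i: c_i\neq0\}\subseteq E$. A minimum-weight codeword is a nonzero codeword of minimal weight. $\mathcal{B}=\{x^ry^s : 0\le r\le q,\ 0\le s\le q^2-q-1\}\cup\{y^s : q^2-q\le s\le q^2-1\}$, and $\Lambda_{\mathcal{B}}=\{w(x^ry^s): x^ry^s\in\mathcal{B}\}$. $\Lambda$ is the numerical semigroup generated by $q$ and $q+1$. Put $\delta(m)=m-q^2+q+2$. $\widetilde m$ denotes the minimum integer $m'\ge m$ such that both $m'+1\in\Lambda_{\mathcal{B}}$ and $\delta(m')\in\Lambda$; and $\widetilde\delta_m=\delta(\widetilde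 m)$. For $m$ in the range considered with $m<\widetilde m$, $\widetilde\delta_m$ is a multiple $\mu q$ of $q$, which defines $\mu$. $\prec$ is the degree reverse lexicographic order with $y>x$: $x^{r_1}y^{r_2}\prec x^{s_1}y^{s_2}$ iff $r_1+r_2<s_1+s_2$, or $r_1+r_2=s_1+s_2$ and $r_1>s_1$. $\mathrm{LM}_\prec(F)$ is the $\prec$-largest monomial occurring in $F\in A$. Curves are defined by polynomials in $A$; intersections are scheme-theoretic in the affine plane, i.e. $D=\mathcal{H}\cap\mathcal{X}$ means $I_D=\langle H,F\rangle$ and $D=\mathcal{X}\cap\mathcal{Y}$ means $I_D=\langle F_1,F_2\rangle$. *)

(* Defs.v *)
From mathcomp Require Import all_boot all_order all_algebra.
From mathcomp Require Import mpoly.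

Set Implicit Arguments.
Unset Strict Implicit.
Unset Printing Implicit Defensive.

Import GRing.Theory.
Local Open Scope ring_scope.

Definition ix : 'I_2 := ord0.
Definition iy : 'I_2 := ord_max.

(* the exponent of x^r y^s *)
Definition xymon (r s : nat) : 'X_{1..2} := (U_(ix) *+ r + U_(iy) *+ s)%MM.

Definition weight (q : nat) (u : 'X_{1..2}) : nat := (u ix * q + u iy * q.+1)%N.

(* In two variables with y > x this is the degree reverse lexicographic
   order. *)
Definition degrevlex_lt (u v : 'X_{1..2}) : bool :=
  (mdeg u < mdeg v)%N || (mdeg u == mdeg v) && (v ix < u ix)%N.

Definition is_LM (R : nzRingType) (f : {mpoly R[2]}) (u : 'X_{1..2}) : Prop :=
  u \in msupp f /\
  forall v, v \in msupp f -> v != u -> degrevlex_lt v u.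

Definition in_semigroup (q l : nat) : Prop :=
  exists a b : nat, l = (a * q + b * q.+1)%N.

Definition in_B (q : nat) (u : 'X_{1..2}) : bool :=
  (u ix <= q)%N && (u iy <= q ^ 2 - q - 1)%N
  || [&& u ix == 0%N, (q ^ 2 - q <= u iy)%N & (u iy <= q ^ 2 - 1)%N].

Definition in_Lambda_B (q l : nat) : Prop :=
  exists2 u, in_B q u & weight q u = l.

(* m - q^2 + q + 2; the truncated subtraction is exact as soon as
   q^2 - q - 1 <= m, hence for every value at which it is used. *)
Definition delta (q m : nat) : nat := (m + q + 2 - q ^ 2)%N.

Definition is_mtilde (q m mt : nat) : Prop :=
  [/\ (m <= mt)%N, in_Lambda_B q mt.+1, in_semigroup q (delta q mt)
    & forall m' : nat, (m <= m')%N -> in_Lambda_B q m'.+1 ->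
        in_semigroup q (delta q m') -> (mt <= m')%N].

Section HermitianCurve.
Variables (F : finFieldType) (q : nat).

Definition evalpt (f : {mpoly F[2]}) (P : F * F) : F :=
  f.@[fun i => if i == ix then P.1 else P.2].

Definition herm : {mpoly F[2]} := 'X_ix ^+ q.+1 - 'X_iy ^+ q - 'X_iy.

(* The set E of F-rational points, as a finite type: divisors are terms of
   {set hermpt} and words, indexed by P_1, ..., P_n, of {ffun hermpt -> F}. *)
Definition hermpt := {P : F * F | evalpt herm P == 0}.

Definition evalword (f : {mpoly F[2]}) : {ffun hermpt -> F} :=
  [ffun P => evalpt f (val P)].

Definition dual_code (L : {ffun hermpt -> F} -> Prop)
    (c : {ffun hermpt -> F}) : Prop :=
  forall v, L v -> \sum_P c P * v P = 0.

(* Polynomial representatives of the classes in V_m: evaluation at the points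
   of E factors through A_E. *)
Definition in_V (m : nat) (f : {mpoly F[2]}) : Prop :=
  forall u, u \in msupp f -> (weight q u <= m)%N.

Definition hermitian_code (m : nat) : {ffun hermpt -> F} -> Prop :=
  dual_code (fun v => exists2 f, in_V m f & v = evalword f).

Definition word_support (c : {ffun hermpt -> F}) : {set hermpt} :=
  [set P | c P != 0].

Definition min_weight_codeword (C : {ffun hermpt -> F} -> Prop)
    (c : {ffun hermpt -> F}) : Prop :=
  [/\ C c, c != [ffun=> 0]
    & forall c', C c' -> c' != [ffun=> 0] ->
        (#|word_support c| <= #|word_support c'|)%N].

Definition in_ideal (D : {set hermpt}) (f : {mpoly F[2]}) : Prop :=
  forall P, P \in D -> evalpt f (val P) = 0.

(* I_D = <f1, f2> *)
Definition is_intersection (D : {set hermpt}) (f1 f2 : {mpoly F[2]}) : Prop :=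
  forall g, in_ideal D g <-> exists a b : {mpoly F[2]}, g = a * f1 + b * f2.

End HermitianCurve.

(* Main.v *)
Require Import Defs.
From mathcomp Require Import all_boot all_order all_algebra.
From mathcomp Require Import mpoly finfield.
From mathcomp Require Import zify ring.

(** Write [w] for the weight and [2g = q^2 - q].  A word [c] of support [D] gives
   a linear functional [f |-> sum_P c_P f(P)] on [F[x,y]]; it kills the
   vanishing ideal of [D], and [c] is a codeword when it kills all monomials of
   weight at most [m].  Let [l > m] be the least weight of a monomial that it
   does not kill.  All monomials of weight [l] then have nonzero image, because
   [x^(q+1)] and [y^q] agree on the curve up to the smaller term [y].  Hence
   no polynomial vanishing on [D] has a leading weight dividing [l], that is, a
   leading weight [a] with [l - a] again a weight ([leading_weight]), and
   [D] has at least as many points as there are such [a] ([order_bound]).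

   Write [l = w(x^r y^s)] with [s < q].  The hypotheses on [m] say that
   [m - (2g - 2)] lies strictly between [(mu-1)(q+1)] and [mu q]
   ([gap_location]), hence [l >= w(x^(q-1) y^(mu-1))].  For [r < q] the divisors
   of [l] form the box [a <= r, b <= s], and the bound is the product
   [(r+1)(s+1)] of two numbers at most [q] whose sum is at least [mu + q]; it is
   at least [mu q], with equality only for [(r+1, s+1) = (mu, q)] or [(q, mu)].
   For [r >= q] the bound is larger ([order_bound_min]).  The two cases of
   equality are the two types of complete intersections.

   If [D] has [mu q] points, then the monomials of the box restrict to a basis of
   the functions on [D].  Adding [x^mu], or [x^q] and [y^mu], gives polynomials
   vanishing on [D] with these leading monomials ([new_lead]).  They generate
   the vanishing ideal, the first one together with [H]: every polynomial reduces
   to the box, where nothing but zero vanishes on [D] ([leads_generate]).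

   Conversely, let the vanishing ideal of [D] be generated by two polynomials with
   leading monomials [x^i] and [y^j], where [i j = mu q].  The leading monomials
   are coprime, so no nonzero combination of the [i j] monomials of the box lies
   in the ideal ([coprime_leads]), and [D] has exactly [i j] points.
   Polynomials of weight at most [m] reduce to combinations avoiding the corner
   [x^(i-1) y^(j-1)] of the box, whose weight exceeds [m]; their restrictions
   thus do not fill the functions on [D], and some codeword is supported in [D]
   ([leads_codeword]).  By the lower bound it is a codeword of minimum weight with
   support [D].  That [mu q] is attained at all is seen on [mu] vertical lines,
   each of which contains [q] points of the curve ([vertical_lines]). *)

Set Implicit Arguments.
Unset Strict Implicit.
Unset Printing Implicit Defensive.

Import GRing.Theory.
Local Open Scope ring_scope.

(** * Monomials in two variables *)

Lemma ord2P (i : 'I_2) : i = ix \/ i = iy.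
Proof. by case: i => [[|[|//]] lti]; [left|right]; apply: val_inj. Qed.

Lemma monP (u v : 'X_{1..2}) : u ix = v ix -> u iy = v iy -> u = v.
Proof. by move=> ex ey; apply/mnmP=> i; case: (ord2P i) => ->. Qed.

Lemma xymonx r s : xymon r s ix = r.
Proof. by rewrite /xymon mnmDE !mulmnE !mnm1E /= mul1n mul0n addn0. Qed.

Lemma xymony r s : xymon r s iy = s.
Proof. by rewrite /xymon mnmDE !mulmnE !mnm1E /= mul1n mul0n. Qed.

Definition xymonE := (xymonx, xymony).

Lemma addxyx (u : 'X_{1..2}) r s : (u + xymon r s)%MM ix = (u ix + r)%N.
Proof. by rewrite mnmDE xymonE. Qed.

Lemma addxyy (u : 'X_{1..2}) r s : (u + xymon r s)%MM iy = (u iy + s)%N.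
Proof. by rewrite mnmDE xymonE. Qed.

Definition addxyE := (addxyx, addxyy).

Lemma xymon_eta (u : 'X_{1..2}) : xymon (u ix) (u iy) = u.
Proof. by apply: monP; rewrite xymonE. Qed.

Lemma mdeg2 (u : 'X_{1..2}) : mdeg u = (u ix + u iy)%N.
Proof.
rewrite mdegE big_ord_recl big_ord1; congr (u _ + u _)%N; exact: val_inj.
Qed.

Lemma xymon_dvd i j (u : 'X_{1..2}) :
  (i <= u ix)%N -> (j <= u iy)%N -> (xymon i j <= u)%MM.
Proof.
by move=> lx ly; apply/mnm_lepP=> e; case: (ord2P e) => ->; rewrite xymonE.
Qed.

Lemma weightD q : {morph weight q : u v / (u + v)%MM >-> (u + v)%N}.
Proof. by move=> u v; rewrite /weight !mnmDE; lia. Qed.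

Lemma weight_xymon q r s : weight q (xymon r s) = (r * q + s * q.+1)%N.
Proof. by rewrite /weight !xymonE. Qed.

Lemma weight_addxy q u r s :
  weight q (u + xymon r s)%MM = (weight q u + (r * q + s * q.+1))%N.
Proof. by rewrite weightD weight_xymon. Qed.

Lemma weight_inj q (u v : 'X_{1..2}) : (u iy < q)%N -> (v iy < q)%N ->
  weight q u = weight q v -> u = v.
Proof.
move=> lu lv; rewrite /weight => e.
have e' : ((u ix + u iy) * q + u iy = (v ix + v iy) * q + v iy)%N by lia.
have q_gt0 : (0 < q)%N by exact: leq_trans lu.
have ey : u iy = v iy.
  by have := congr1 (modn^~ q) e'; rewrite !modnMDl !modn_small.
by apply: monP => //; rewrite ey in e'; nia.
Qed.

(** * Leading monomials for an additive weight *)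

Section LeadingMonomials.
Variables (F : fieldType) (w : 'X_{1..2} -> nat).
Hypothesis wD : {morph w : u v / (u + v)%MM >-> (u + v)%N}.
Implicit Types (f g h a b : {mpoly F[2]}) (u v t : 'X_{1..2}).

Definition strict_lead f u : Prop :=
  f@_u != 0 /\ forall v, v \in msupp f -> v != u -> (w v < w u)%N.

Lemma strict_lead_le f u v : strict_lead f u -> v \in msupp f -> (w v <= w u)%N.
Proof. by case=> _ lf fv; case: (eqVneq v u) => [->//|/(lf v fv)/ltnW]. Qed.

Lemma strict_leadMX f u v : strict_lead f u -> strict_lead (f * 'X_[v]) (v + u)%MM.
Proof.
case=> fu lf; split; first by rewrite mcoeffMX.
move=> t; rewrite (perm_mem (msuppMX f v)) => /mapP[t' ft' ->].
rewrite !wD ltn_add2l => ne; apply: lf => //.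
by apply: contraNneq ne => ->.
Qed.

Lemma strict_lead_multiple f u v : strict_lead f v -> (v <= u)%MM ->
  strict_lead (f * 'X_[u - v]) u.
Proof.
by move=> lf le; rewrite -[X in strict_lead _ X](submK le); exact: strict_leadMX.
Qed.

(** If no monomial of [a] is above [v], then the term of [a * f] at [v + u] comes
   from the leading term of [f] alone. *)
Lemma mcoeff_lead_mul a f u v : strict_lead f u ->
  (forall t, t \in msupp a -> w t <= w v)%N ->
  (a * f)@_(v + u)%MM = a@_v * f@_u.
Proof.
case=> fu lf la.
have -> : f = f@_u *: 'X_[u] + (f - f@_u *: 'X_[u]) by rewrite addrC subrK.
set r := f - _.
have lr t : t \in msupp r -> (w t < w u)%N.
  rewrite mcoeff_msupp /r mcoeffB mcoeffZ mcoeffX => rt.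
  have ne : t != u by apply: contraNneq rt => ->; rewrite eqxx mulr1 subrr.
  apply: (lf t _ ne); rewrite mcoeff_msupp; move: rt.
  by rewrite [u == t]eq_sym (negbTE ne) mulr0 subr0.
have -> : (f@_u *: 'X_[u] + r)@_u = f@_u by rewrite /r addrC subrK.
rewrite mulrDr mcoeffD -scalerAr mcoeffZ addmC mcoeffMX [X in _ + X]memN_msupp_eq0.
  by rewrite addr0 mulrC.
apply/negP=> /msuppM_le/allpairsP[[t t'] /= [at_ rt' e]].
have := congr1 w e; rewrite !wD; have := la _ at_; have := lr _ rt'.
lia.
Qed.

Lemma msupp_lead_mul a f u t : strict_lead f u -> t \in msupp (a * f) ->
  (forall v, v \in msupp a -> w v + w u <= w t)%N ->
  exists2 v, v \in msupp a & t = (v + u)%MM.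
Proof.
move=> [fu lf] /msuppM_le/allpairsP[[v u'] /= [av fu' ->]] la.
exists v => //; case: (eqVneq u' u) => [->//|ne].
by have := la _ av; have := lf _ fu' ne; rewrite wD; lia.
Qed.

(** Leading terms are cancelled from the top weight downwards.  A reduction
   step on one monomial produces only smaller weights, so the weight bound
   drives the induction, and it is inherited by the reduced polynomial. *)
Lemma reduction (J : {mpoly F[2]} -> Prop) (nf : pred 'X_{1..2}) :
    J 0 -> (forall f g, J f -> J g -> J (f + g)) ->
    (forall c f, J f -> J (c *: f)) ->
    (forall u, ~~ nf u -> exists2 h, J h & strict_lead h u) ->
  forall N g, (forall u, u \in msupp g -> w u < N)%N ->
  exists2 g', J (g - g') & forall u, u \in msupp g' -> nf u && (w u < N)%N.
Proof.
move=> J0 JD JZ leadJ; elim=> [|N IH] g lg.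
  exists g; first by rewrite subrr.
  by move=> u /lg.
pose P f := exists2 f', J (f - f') &
  forall u, u \in msupp f' -> nf u && (w u < N.+1)%N.
have P0 : P 0 by exists 0; rewrite ?subrr // => u; rewrite msupp0.
have PD f1 f2 : P f1 -> P f2 -> P (f1 + f2).
  move=> [r1 J1 n1] [r2 J2 n2]; exists (r1 + r2).
    have -> : f1 + f2 - (r1 + r2) = (f1 - r1) + (f2 - r2) by ring.
    exact: JD.
  by move=> u /msuppD_le; rewrite mem_cat => /orP[/n1|/n2].
have PZ c f : P f -> P (c *: f).
  move=> [r J1 n1]; exists (c *: r); first by rewrite -scalerBr; exact: JZ.
  by move=> u /msuppZ_le/n1.
(* By linearity it is enough to treat a single monomial. *)
rewrite -/(P g) (mpolyE g) big_seq; apply: (big_ind P) => // u gu.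
apply: (PZ); have lu := lg u gu.
have [nu|nu] := boolP (nf u).
  exists 'X_[u]; first by rewrite subrr.
  by move=> v; rewrite msuppX inE => /eqP->; rewrite nu.
have [h Jh [hu lh]] := leadJ u nu.
pose k : {mpoly F[2]} := 'X_[u] - (h@_u)^-1 *: h.
have [k' Jk nk] : exists2 k', J (k - k') &
    forall u, u \in msupp k' -> nf u && (w u < N)%N.
  apply: IH => v; rewrite mcoeff_msupp mcoeffB mcoeffX mcoeffZ => kv.
  have ne : v != u by apply: contraNneq kv => ->; rewrite eqxx mulVf ?subrr.
  suff /lh/(_ ne) : v \in msupp h by lia.
  rewrite mcoeff_msupp; apply: contraNneq kv => ->.
  by rewrite [u == v]eq_sym (negbTE ne) mulr0 subrr.
exists k'; last by move=> v /nk/andP[-> /ltnW].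
have -> : 'X_[u] - k' = (h@_u)^-1 *: h + (k - k') by rewrite /k; ring.
by apply: JD => //; exact: JZ.
Qed.

(** The first cofactor is made free of multiples of [y^j] by dividing it by
   [f2]; the top monomials of [a * f1] and [b * f2] then have [y]-exponents on
   different sides of [j], so they cannot cancel, and one of them survives in
   [g]. *)
Lemma coprime_leads f1 f2 i j g a b :
    strict_lead f1 (xymon i 0) -> strict_lead f2 (xymon 0 j) ->
    g = a * f1 + b * f2 ->
    (forall u, u \in msupp g -> (u ix < i) && (u iy < j))%N ->
  g = 0.
Proof.
move=> l1 l2 eg ng.
have [a' [k ek] na'] : exists2 a' : {mpoly F[2]}, exists k, a - a' = k * f2 &
    forall u, u \in msupp a' -> (u iy < j)%N.
  have [|||||a' Ja' na'] := @reduction (fun f => exists k, f = k * f2)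
      (fun u => u iy < j)%N _ _ _ _ (\sum_(u <- msupp a) w u).+1 a.
  - by exists 0; rewrite mul0r.
  - by move=> f g' [c ->] [d ->]; exists (c + d); rewrite mulrDl.
  - by move=> c f [d ->]; exists (c *: d); rewrite scalerAl.
  - move=> u nu; exists (f2 * 'X_[u - xymon 0 j]).
      by exists 'X_[u - xymon 0 j]; rewrite mulrC.
    by apply: strict_lead_multiple l2 _; apply: xymon_dvd; rewrite // leqNgt.
  - by move=> u au; rewrite ltnS (big_rem u) //= leq_addr.
  exists a' => // u /na'/andP[] //.
have {}eg : g = a' * f1 + (b + k * f1) * f2.
  by rewrite eg -[in LHS](subrK a' a) ek; ring.
move: (b + _) eg => b' eg; clear a b k ek.
(* [g = 0] for cofactors of any bounded weight: the bound can be lowered. *)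
suff H N : (forall v, v \in msupp a' -> w v + w (xymon i 0) < N)%N ->
           (forall v, v \in msupp b' -> w v + w (xymon 0 j) < N)%N -> g = 0.
  pose N := (\sum_(u <- msupp a') w u + \sum_(u <- msupp b') w u
             + w (xymon i 0) + w (xymon 0 j)).+1.
  by apply: (H N) => v hv; rewrite /N (big_rem v hv) /=; lia.
elim: N => [|N IH] la lb.
  have a0 : a' = 0.
    apply: msuppnil0; case: (msupp a') la => // v s /(_ v).
    by rewrite mem_head => /(_ isT).
  have b0 : b' = 0.
    apply: msuppnil0; case: (msupp b') lb => // v s /(_ v).
    by rewrite mem_head => /(_ isT).
  by rewrite eg a0 b0 !mul0r addr0.
apply: IH => v hv; rewrite ltn_neqAle -ltnS ?la ?lb // andbT; apply/eqP=> eN.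
- have g_top : (v + xymon i 0)%MM \in msupp g.
    rewrite mcoeff_msupp eg mcoeffD (mcoeff_lead_mul l1); last first.
      by move=> t /la; rewrite -eN; lia.
    rewrite [X in _ + X]memN_msupp_eq0 ?addr0.
      by apply: mulf_neq0; [rewrite -mcoeff_msupp | case: l1].
    apply/negP=> /(msupp_lead_mul l2)[t /lb|t _ e].
      by rewrite wD -eN; lia.
    move/mnmP: e => /(_ iy); rewrite !addxyE.
    by have := na' _ hv; lia.
  by have := ng _ g_top; rewrite !addxyE; lia.
- have g_top : (v + xymon 0 j)%MM \in msupp g.
    rewrite mcoeff_msupp eg mcoeffD (mcoeff_lead_mul l2); last first.
      by move=> t /lb; rewrite -eN; lia.
    rewrite [X in X + _]memN_msupp_eq0 ?add0r.
      by apply: mulf_neq0; [rewrite -mcoeff_msupp | case: l2].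
    apply/negP=> /(msupp_lead_mul l1)[t /la|t at_ e].
      by rewrite wD -eN; lia.
    move/mnmP: e => /(_ iy); rewrite !addxyE.
    by have := na' _ at_; lia.
  by have := ng _ g_top; rewrite !addxyE; lia.
Qed.

(** A monomial outside the box [u_x < i], [u_y < j] is divisible by [x^i] or
   [y^j], hence is the leading monomial of a member of the ideal. *)
Lemma box_reduction f1 f2 i j :
    strict_lead f1 (xymon i 0) -> strict_lead f2 (xymon 0 j) ->
  forall N g, (forall u, u \in msupp g -> w u < N)%N ->
  exists2 g', exists a b, g - g' = a * f1 + b * f2 &
    forall u, u \in msupp g' -> [&& u ix < i, u iy < j & w u < N]%N.
Proof.
move=> l1 l2 N g lg.
have [||||g' Jg ng] := @reduction (fun f => exists a b, f = a * f1 + b * f2)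
    (fun u => (u ix < i) && (u iy < j))%N _ _ _ _ N g lg.
- by exists 0, 0; rewrite !mul0r addr0.
- by move=> f h [a [b ->]] [c [d ->]]; exists (a + c), (b + d); ring.
- move=> c f [a [b ->]]; exists (c *: a), (c *: b).
  by rewrite -!scalerAl scalerDr.
- move=> u; rewrite negb_and -!leqNgt => /orP[ge|ge].
    exists (f1 * 'X_[u - xymon i 0]); last first.
      by apply: strict_lead_multiple l1 _; exact: xymon_dvd.
    by exists 'X_[u - xymon i 0], 0; rewrite mul0r addr0 mulrC.
  exists (f2 * 'X_[u - xymon 0 j]); last first.
    by apply: strict_lead_multiple l2 _; exact: xymon_dvd.
  by exists 0, 'X_[u - xymon 0 j]; rewrite mul0r add0r mulrC.
by exists g' => // u /ng; rewrite andbA.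
Qed.

End LeadingMonomials.

(** * Words, functionals on polynomials, and linear algebra *)

Section Evaluation.
Variables (F : finFieldType) (q : nat).
Implicit Types (f g : {mpoly F[2]}) (D : {set hermpt F q}).
Implicit Types (c : {ffun hermpt F q -> F}) (u v : 'X_{1..2}).

(** The linear functional on [F[x,y]] attached to a word.  Its values on monomials
   decide membership in the code, and it is zero on the vanishing ideal of the
   support. *)
Definition pairing c f : F := \sum_P c P * evalpt f (val P).

Lemma evalptD f g P : evalpt (f + g) P = evalpt f P + evalpt g P.
Proof. exact: mevalD. Qed.

Lemma evalptB f g P : evalpt (f - g) P = evalpt f P - evalpt g P.
Proof. exact: mevalB. Qed.

Lemma evalptM f g P : evalpt (f * g) P = evalpt f P * evalpt g P.
Proof. exact: mevalM. Qed.

Lemma evalpt_xymon u P : evalpt ('X_[u] : {mpoly F[2]}) P = P.1 ^+ u ix * P.2 ^+ u iy.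
Proof.
rewrite /evalpt mevalX big_ord_recl big_ord1.
by rewrite (_ : lift ord0 ord0 = iy) //; apply: val_inj.
Qed.

Lemma evalpt_herm P :
  (evalpt (herm F q) P == 0) = (P.2 ^+ q + P.2 == P.1 ^+ q.+1).
Proof.
rewrite /evalpt /herm !mevalB !rmorphXn /= !mevalXU /=.
by rewrite -addrA -opprD subr_eq0 eq_sym.
Qed.

Lemma evalptE f P :
  evalpt f P = \sum_(u <- msupp f) f@_u * evalpt ('X_[u] : {mpoly F[2]}) P.
Proof.
rewrite [in LHS](mpolyE f) /evalpt raddf_sum; apply: eq_bigr => u _.
exact: mevalZ.
Qed.

Lemma pairingE c f :
  pairing c f = \sum_(u <- msupp f) f@_u * pairing c 'X_[u].
Proof.
under eq_bigr do rewrite mulr_sumr; rewrite exchange_big; apply: eq_bigr => P _.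
by rewrite [in LHS]evalptE mulr_sumr; apply: eq_bigr => u _; rewrite mulrCA.
Qed.

Lemma pairingB c f g : pairing c (f - g) = pairing c f - pairing c g.
Proof.
by rewrite -sumrB; apply: eq_bigr => P _; rewrite evalptB mulrBr.
Qed.

Lemma in_idealD D f g : in_ideal D f -> in_ideal D g -> in_ideal D (f + g).
Proof. by move=> hf hg P DP; rewrite evalptD hf ?hg ?addr0. Qed.

Lemma in_idealM D f g : in_ideal D g -> in_ideal D (f * g).
Proof. by move=> hg P DP; rewrite evalptM hg ?mulr0. Qed.

Lemma in_idealB D f g : in_ideal D f -> in_ideal D g -> in_ideal D (f - g).
Proof. by move=> hf hg P DP; rewrite evalptB hf ?hg ?subr0. Qed.

Lemma in_ideal_comb D f1 f2 a b :
  in_ideal D f1 -> in_ideal D f2 -> in_ideal D (a * f1 + b * f2).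
Proof. by move=> h1 h2; apply: in_idealD; exact: in_idealM. Qed.

Lemma herm_in_ideal D : in_ideal D (herm F q).
Proof. by move=> P _; exact: (eqP (valP P)). Qed.

Lemma pairing_ideal c D f : word_support c \subset D -> in_ideal D f ->
  pairing c f = 0.
Proof.
move=> /subsetP sD fD; apply: big1 => P _; have [->|c0] := eqVneq (c P) 0.
  by rewrite mul0r.
by rewrite fD ?mulr0 //; apply: sD; rewrite inE.
Qed.

Lemma hermitian_codeP m c : hermitian_code m c <->
  forall u, (weight q u <= m)%N -> pairing c 'X_[u] = 0.
Proof.
split=> [Cc u lu|orth v [f Vf ->]].
  have Vu : exists2 f : {mpoly F[2]},
      in_V q m f & evalword q ('X_[u] : {mpoly F[2]}) = evalword q f.
    by exists 'X_[u] => // v; rewrite msuppX inE => /eqP->.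
  rewrite -[RHS](Cc _ Vu).
  by apply: eq_bigr => P _; rewrite ffunE.
transitivity (pairing c f); first by apply: eq_bigr => P _; rewrite ffunE.
by rewrite pairingE big_seq big1 // => u /Vf/orth ->; rewrite mulr0.
Qed.

(** Evaluation at the points of a finite plane is onto, hence a nonzero word
   gives a nonzero functional. *)
Lemma pairing_neq0 c : c != [ffun=> 0] -> exists u, pairing c 'X_[u] != 0.
Proof.
move=> c_neq0; have /existsP[P cP] : [exists P, c P != 0].
  apply: contraNT c_neq0; rewrite negb_exists => /forallP c0.
  by apply/eqP/ffunP=> P; rewrite ffunE; apply/eqP; rewrite -[_ == _]negbK.
(* [g] vanishes everywhere in the plane except at [P]. *)
pose g : {mpoly F[2]} := (\prod_(a | a != (val P).1) ('X_ix - a%:MP))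
                       * (\prod_(b | b != (val P).2) ('X_iy - b%:MP)).
have evg Q : evalpt g Q = (\prod_(a | a != (val P).1) (Q.1 - a))
                        * (\prod_(b | b != (val P).2) (Q.2 - b)).
  rewrite evalptM /evalpt !rmorph_prod; congr (_ * _); apply: eq_bigr => a _;
  by rewrite /= mevalB mevalXU mevalC.
have cg : pairing c g != 0.
  rewrite /pairing (bigD1 P) //= [X in _ + X]big1 => [|Q neQ].
    rewrite addr0 mulf_neq0 // evg mulf_neq0 // prodf_seq_neq0;
    by apply/allP=> a _; apply/implyP; rewrite subr_eq0 eq_sym.
  rewrite evg; have [e1|n1] := eqVneq (val Q).1 (val P).1.
    rewrite [\prod_(b | b != (val P).2) _](bigD1 (val Q).2) /= ?subrr ?mul0r ?mulr0 //.
    apply: contraNneq neQ => e2; apply/eqP/val_inj.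
    rewrite [LHS]surjective_pairing [RHS]surjective_pairing.
    by congr (_, _); [exact: e1 | exact: e2].
  by rewrite (bigD1 (val Q).1) //= subrr !mul0r mulr0.
have [|/hasPn all0] := boolP (has (fun u => pairing c 'X_[u] != 0) (msupp g)).
  by case/hasP=> u _; exists u.
case/eqP: cg; rewrite pairingE big_seq big1 // => u /all0; rewrite negbK.
by move=> /eqP->; rewrite mulr0.
Qed.

Lemma row_kernel m n (A : 'M[F]_(m, n)) : (n < m)%N ->
  exists2 v : 'rV_m, v != 0 & v *m A = 0.
Proof.
move=> lt_nm; have : kermx A != 0.
  by rewrite -mxrank_eq0 mxrank_ker -lt0n subn_gt0 (leq_ltn_trans (rank_leq_col A)).
by case/rowV0Pn=> v /sub_kermxP vA v0; exists v.
Qed.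

Lemma vanishing_combination D (l : seq 'X_{1..2}) :
  uniq l -> (#|D| < size l)%N ->
  exists g, [/\ g != 0, {subset msupp g <= l} & in_ideal D g].
Proof.
move=> ul ltDl; pose mon (i : 'I_(size l)) := nth 0%MM l i.
pose A : 'M[F]_(size l, #|D|) :=
  \matrix_(i, j) evalpt 'X_[mon i] (val (enum_val j)).
have [v v0 vA] := row_kernel A ltDl.
pose g : {mpoly F[2]} := \sum_i v 0 i *: 'X_[mon i].
have gmon i : g@_(mon i) = v 0 i.
  rewrite /g raddf_sum (bigD1 i) //= mcoeffZ mcoeffX eqxx mulr1.
  rewrite big1 ?addr0 // => j ne; rewrite mcoeffZ mcoeffX.
  by rewrite nth_uniq // (inj_eq val_inj) (negbTE ne) mulr0.
exists g; split.
- apply: contraNneq v0 => g0; apply/eqP/rowP=> i.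
  by rewrite -gmon g0 mcoeff0 mxE.
- move=> u; rewrite mcoeff_msupp /g raddf_sum /= => gu.
  apply: contraNT gu => ul'; apply/eqP/big1 => i _; rewrite mcoeffZ mcoeffX.
  by case: eqVneq => [e|_]; rewrite ?mulr0 //; rewrite -e mem_nth in ul'.
- move=> P DP; have := congr1 (fun B : 'rV_#|D| => B 0 (enum_rank_in DP P)) vA.
  rewrite !mxE => e; rewrite -[RHS]e /evalpt /g raddf_sum.
  apply: eq_bigr => i _; rewrite /= mevalZ !mxE enum_rankK_in //.
Qed.

Lemma orthogonal_word D (l : seq 'X_{1..2}) : (size l < #|D|)%N ->
  exists c, [/\ c != [ffun=> 0], word_support c \subset D
    & forall u, u \in l -> pairing c 'X_[u] = 0].
Proof.
move=> ltlD.
pose A : 'M[F]_(#|D|, size l) :=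
  \matrix_(i, j) evalpt 'X_[nth 0%MM l j] (val (enum_val i)).
have [v v0 vA] := row_kernel A ltlD.
pose c : {ffun hermpt F q -> F} :=
  [ffun P => \sum_(i < #|D|) (if enum_val i == P then v 0 i else 0)].
have cval i : c (enum_val i) = v 0 i.
  rewrite ffunE (bigD1 i) //= eqxx big1 ?addr0 // => j ne.
  by rewrite (inj_eq enum_val_inj) (negbTE ne).
exists c; split.
- apply: contraNneq v0 => c0; apply/eqP/rowP=> i.
  by rewrite -cval c0 ffunE mxE.
- apply/subsetP=> P; rewrite inE; apply: contraNT => nDP; rewrite ffunE big1 //.
  by move=> i _; case: eqP => // e; rewrite -e enum_valP in nDP.
- move=> u lu; pose j := Ordinal (etrans (index_mem u l) lu).
  have := congr1 (fun B : 'rV_(size l) => B 0 j) vA.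
  rewrite !mxE => e; rewrite -[RHS]e; under eq_bigr do rewrite mxE nth_index //.
  under [RHS]eq_bigr do rewrite -cval.
  rewrite /pairing (bigID (fun P => P \in D)) /= [X in _ + X]big1 ?addr0.
    by rewrite big_enum_val.
  move=> P nDP; rewrite ffunE big1 ?mul0r // => i _.
  by case: eqP => // e'; rewrite -e' enum_valP in nDP.
Qed.

End Evaluation.

(** * The leading weight of a codeword *)

Section LeadingWeight.
Variables (F : finFieldType) (q : nat).
Hypothesis q_gt1 : (1 < q)%N.
Implicit Types (c : {ffun hermpt F q -> F}) (u v : 'X_{1..2}).

Lemma pairing_herm c v :
  pairing c 'X_[v + xymon q.+1 0] =
  pairing c 'X_[v + xymon 0 q] + pairing c 'X_[v + xymon 0 1].
Proof.
rewrite -big_split /=; apply: eq_bigr => P _; rewrite -mulrDr; congr (_ * _).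
rewrite !evalpt_xymon !addxyE !addn0 !exprD.
have : (val P).1 ^+ q.+1 = (val P).2 ^+ q + (val P).2.
  by apply/eqP; rewrite eq_sym -evalpt_herm; exact: (valP P).
by move=> ->; ring.
Qed.

(** Rewriting [y^q] as [x^(q+1) - y] trades a monomial for one of equal weight
   and one of smaller weight.  So on weights at which smaller monomials are
   killed, only the weight matters. *)
Lemma pairing_weight c l :
    (forall u, (weight q u < l)%N -> pairing c 'X_[u] = 0) ->
  forall u, weight q u = l -> exists v, [/\ (v iy < q)%N, weight q v = l
    & pairing c 'X_[v] = pairing c 'X_[u]].
Proof.
move=> low u; have [n] := ubnP (u iy); elim: n u => // n IH u le_un wu.
have [lt_uq|le_qu] := ltnP (u iy) q; first by exists u.
pose v := xymon (u ix) (u iy - q).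
have eu : u = (v + xymon 0 q)%MM.
  by apply: monP; rewrite addxyE /v xymonE ?addn0 // subnK.
have [||v' [v'q wv' ev']] := IH (v + xymon q.+1 0)%MM.
- by rewrite addxyE /v xymonE; lia.
- by rewrite -wu eu !weight_addxy; lia.
exists v'; split=> //; rewrite ev' pairing_herm -eu [X in _ + X]low ?addr0 //.
by rewrite -wu eu !weight_addxy; nia.
Qed.

(** Let [l] be the least weight of a monomial on which the functional of [c]
   is nonzero.  By the previous lemma it is nonzero on every monomial of
   weight [l].  If a polynomial with leading monomial [u] vanished on the
   support, multiplying it by a monomial of weight [l - w(u)] would give a
   polynomial killed by the functional although only its leading term
   contributes.  So leading monomials of the vanishing ideal avoid all divisors
   of [l]: this is the order bound of Feng and Rao. *)
Lemma leading_weight m c : hermitian_code m c -> c != [ffun=> 0] ->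
  exists r s, [/\ (s < q)%N, (m < r * q + s * q.+1)%N
    & forall g u u', in_ideal (word_support c) g -> strict_lead (weight q) g u ->
        (weight q u + weight q u')%N <> (r * q + s * q.+1)%N].
Proof.
move=> /hermitian_codeP Cc /pairing_neq0[u0 cu0].
pose p l := [exists a : 'I_l.+1, exists b : 'I_l.+1,
  (weight q (xymon a b) == l) && (pairing c 'X_[xymon a b] != 0)].
have pP u : pairing c 'X_[u] != 0 -> p (weight q u).
  move=> cu.
  have lx : (u ix < (weight q u).+1)%N by rewrite /weight; nia.
  have ly : (u iy < (weight q u).+1)%N by rewrite /weight; nia.
  apply/existsP; exists (Ordinal lx); apply/existsP; exists (Ordinal ly) => /=.
  by rewrite xymon_eta eqxx.
have ex_l : exists l, p l by exists (weight q u0); exact: pP.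
case: (ex_minnP ex_l) => l /existsP[a /existsP[b /andP[/eqP wl cl]]] minl.
have low u : (weight q u < l)%N -> pairing c 'X_[u] = 0.
  by move=> lt_ul; apply: contraTeq lt_ul => /pP/minl; rewrite -leqNgt.
have [v [vq wv ev]] := pairing_weight low wl.
have top u : weight q u = l -> pairing c 'X_[u] != 0.
  move=> /(pairing_weight low)[v' [v'q wv' <-]].
  by rewrite (@weight_inj q v' v) ?wv ?wv' // ev.
exists (v ix), (v iy); rewrite -/(weight q v) wv; split=> //.
  by rewrite ltnNge -wl; apply: contra cl => /Cc ->.
move=> g u u' Ig lg wuu'.
have [lead0 lead_lt] := strict_leadMX (@weightD q) u' lg.
have := pairing_ideal (subxx _) (in_idealM 'X_[u'] Ig); rewrite mulrC pairingE.
move: lead0; rewrite -mcoeff_msupp => lead_in.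
rewrite (bigD1_seq _ lead_in) ?msupp_uniq //= big_seq_cond big1 ?addr0.
  apply/eqP; rewrite mulf_neq0 -?mcoeff_msupp //.
  by apply: top; rewrite weightD addnC.
move=> t /andP[gt ne]; rewrite low ?mulr0 //.
by rewrite -wuu' addnC -weightD; exact: lead_lt.
Qed.

End LeadingWeight.

(** * Counting divisors of the leading weight *)

Definition rect (A b0 B : nat) : seq 'X_{1..2} :=
  [seq xymon a b | a <- iota 0 A, b <- iota b0 B].

Lemma mem_rect A b0 B u :
  (u \in rect A b0 B) = [&& u ix < A, b0 <= u iy & u iy < b0 + B]%N.
Proof.
apply/allpairsP/idP => [[[a b] /= [la lb ->]]|/and3P[la lb lb']].
  by move: la lb; rewrite !mem_iota !xymonE add0n => /= -> ->.
exists (u ix, u iy); rewrite /= !mem_iota lb lb' xymon_eta.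
by split=> //; rewrite add0n.
Qed.

Lemma size_rect A b0 B : size (rect A b0 B) = (A * B)%N.
Proof. by rewrite size_allpairs !size_iota. Qed.

Lemma rect_uniq A b0 B : uniq (rect A b0 B).
Proof.
apply: allpairs_uniq; rewrite ?iota_uniq // => -[a b] [a' b'] _ _ /= e.
by congr (_, _); [rewrite -(xymonx a b) e xymonx | rewrite -(xymony a b) e xymony].
Qed.

Lemma seq_max (T : eqType) (f : T -> nat) (l : seq T) : l != [::] ->
  exists2 x, x \in l & forall y, y \in l -> (f y <= f x)%N.
Proof.
elim: l => // x [|y l] IH _.
  by exists x; rewrite ?mem_head // => y; rewrite inE => /eqP->.
have [//|z lz maxz] := IH; have [le|/ltnW le] := leqP (f x) (f z).
  by exists z; [rewrite inE lz orbT | move=> t; rewrite inE => /predU1P[->|/maxz]].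
exists x; first exact: mem_head.
move=> t; rewrite inE => /predU1P[->|/maxz /leq_trans -> //]; exact: leqnn.
Qed.

Lemma strict_lead_exists (F : fieldType) q (g : {mpoly F[2]}) : g != 0 ->
    (forall u, u \in msupp g -> u iy < q)%N ->
  exists2 u, u \in msupp g & strict_lead (weight q) g u.
Proof.
rewrite -msupp_eq0 => /(seq_max (weight q))[u gu maxu] lt_q; exists u => //.
split; first by rewrite -mcoeff_msupp.
move=> v gv ne; rewrite ltn_neqAle maxu // andbT; apply: contraNneq ne => e.
by apply/eqP; apply: weight_inj e; exact: lt_q.
Qed.

(** This section assumes of [D] what [leading_weight] proves of the support of a
   codeword: no leading weight of a polynomial vanishing on [D] divides
   the weight of [x^r y^s]. *)
Section OrderBound.
Variables (F : finFieldType) (q : nat) (D : {set hermpt F q}) (r s : nat).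
Hypothesis no_lead : forall (g : {mpoly F[2]}) u u', in_ideal D g ->
  strict_lead (weight q) g u ->
  (weight q u + weight q u')%N <> (r * q + s * q.+1)%N.

Lemma no_lead_box (g : {mpoly F[2]}) u : in_ideal D g ->
  strict_lead (weight q) g u -> ~~ ((u ix <= r) && (u iy <= s))%N.
Proof.
move=> Dg lg; apply/negP=> /andP[lx ly].
apply: (@no_lead g u (xymon (r - u ix) (s - u iy)) Dg lg).
by rewrite weight_xymon /weight; nia.
Qed.

Hypothesis s_lt : (s < q)%N.

(** As [y^q] has the weight of [x^(q+1)], the weight of [x^r y^s] is also that of
   [x^(r-q-1) y^(s+q)] when [r > q].  The monomials with [y]-exponent less
   than [q], which have pairwise distinct weights, that divide one of these two
   monomials are therefore not leading, and they are the ones counted. *)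
Lemma order_bound : (r.+1 * s.+1 + (r - q) * (q - s.+1) <= #|D|)%N.
Proof.
rewrite leqNgt; apply/negP=> ltD.
pose l := rect r.+1 0 s.+1 ++ rect (r - q) s.+1 (q - s.+1).
have ul : uniq l.
  rewrite cat_uniq !rect_uniq andbT /=; apply/hasPn=> u.
  by rewrite !mem_rect; lia.
have [|g [g0 gl Dg]] := @vanishing_combination F q D l ul.
  by rewrite size_cat !size_rect.
have gq u : u \in msupp g -> (u iy < q)%N.
  by move=> /gl; rewrite mem_cat !mem_rect; lia.
have [u /gl ul' lg] := strict_lead_exists g0 gq.
move: ul'; rewrite mem_cat !mem_rect => /orP[in1|in2].
  by have := no_lead_box Dg lg; lia.
apply: (no_lead (u' := xymon (r - q.+1 - u ix) (s + q - u iy)) Dg lg).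
by rewrite weight_xymon /weight; nia.
Qed.

End OrderBound.

(** In the range [r < q] the bound is the product [(r+1)(s+1)] of two numbers at
   most [q] with sum at least [mu + q]; such a product is least when one
   of the factors is [q]. *)
Lemma order_bound_min q mu r s : (0 < mu < q)%N -> (s < q)%N ->
    ((q - 1) * q + (mu - 1) * q.+1 <= r * q + s * q.+1)%N ->
  (mu * q <= r.+1 * s.+1 + (r - q) * (q - s.+1))%N /\
  ((r.+1 * s.+1 + (r - q) * (q - s.+1) <= mu * q)%N ->
   (r = mu - 1 /\ s = q - 1 \/ r = q - 1 /\ s = mu - 1)%N).
Proof.
case: mu => // n; rewrite !subn1 /= => lt_nq s_lt low.
have {}low : (q * q + n * q + n <= r * q + s * q + s + q)%N.
  by move: low; rewrite -{1}(ltn_predK lt_nq) /= -{3 4}(ltn_predK lt_nq); nia.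
have [lt_rq|le_qr] := ltnP r q.
  have -> : (r - q = 0)%N by lia.
  rewrite mul0n addn0.
  have sum : (n.+1 + q <= r.+1 + s.+1)%N.
    rewrite leqNgt; apply/negP=> lt.
    have : ((r + s + 2) * q <= (n + q) * q)%N by rewrite leq_mul2r; lia.
    lia.
  have [a ea] : exists a, q = (r.+1 + a)%N by exists (q - r.+1)%N; lia.
  have [b eb] : exists b, q = (s.+1 + b)%N by exists (q - s.+1)%N; lia.
  have prod : (r.+1 * s.+1 + q * q = q * (r.+1 + s.+1) + a * b)%N.
    by rewrite mulnDr {1 4}ea {1 2}eb; ring.
  have le_sum : (q * (n.+1 + q) <= q * (r.+1 + s.+1))%N by rewrite leq_mul2l sum orbT.
  split; first by lia.
  move=> le.
  have ab0 : (a * b = 0)%N by lia.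
  have : (q * (r.+1 + s.+1) <= q * (n.+1 + q))%N by lia.
  rewrite leq_pmul2l ?(leq_trans _ lt_nq) // => sum'.
  by move/eqP: ab0; rewrite muln_eq0 => /orP[]/eqP e0; [right|left]; lia.
have [t et] : exists t, r = (q + t)%N by exists (r - q)%N; lia.
have -> : (r.+1 * s.+1 + (r - q) * (q - s.+1) = t * q + q.+1 * s.+1)%N.
  have [b eb] : exists b, q = (s.+1 + b)%N by exists (q - s.+1)%N; lia.
  by rewrite et {1}eb addKn (_ : q - s.+1 = b)%N ?[in RHS]eb; [ring | lia].
have big : (n.+1 * q < t * q + q.+1 * s.+1)%N.
  have kge : (n < t + s.+1)%N.
    rewrite ltnNge; apply/negP=> le.
    have : ((t + s.+1) * q <= n * q)%N by rewrite leq_mul2r le orbT.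
    by rewrite et in low; lia.
  have : (n.+1 * q <= (t + s.+1) * q)%N by rewrite leq_mul2r kge orbT.
  lia.
by split; [exact: ltnW | rewrite leqNgt big].
Qed.

(** * Sets of points with two prescribed leading monomials *)

Section Boxes.
Variables (F : finFieldType) (q : nat).
Implicit Types (D : {set hermpt F q}) (f g : {mpoly F[2]}).

Section NoLead.
Variables (D : {set hermpt F q}) (r s : nat).
Hypothesis s_lt : (s < q)%N.
Hypothesis no_lead : forall g u u', in_ideal D g -> strict_lead (weight q) g u ->
  (weight q u + weight q u')%N <> (r * q + s * q.+1)%N.

(** A box with at least as many monomials as [D] has points becomes dependent on [D] once
   [u0] is added; the leading monomial of the resulting polynomial cannot
   lie in the box. *)
Lemma new_lead (u0 : 'X_{1..2}) : (#|D| <= r.+1 * s.+1)%N -> (u0 iy < q)%N ->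
    ~~ ((u0 ix <= r) && (u0 iy <= s))%N ->
  exists2 f, in_ideal D f & strict_lead (weight q) f u0.
Proof.
move=> leD u0q u0box; pose l := u0 :: rect r.+1 0 s.+1.
have [||g [g0 gl Dg]] := @vanishing_combination F q D l.
- by rewrite cons_uniq rect_uniq andbT mem_rect; apply: contra u0box; lia.
- by rewrite -[size l]/(size (rect r.+1 0 s.+1)).+1 size_rect ltnS.
have gq u : u \in msupp g -> (u iy < q)%N.
  by move=> /gl; rewrite inE mem_rect => /predU1P[-> //|]; lia.
have [u /gl] := strict_lead_exists g0 gq.
rewrite inE mem_rect => /predU1P[-> lg|ubox lg]; first by exists g.
by have := no_lead_box no_lead Dg lg; lia.
Qed.

(** Reduction may use any weight [w] for which the two leading monomials are as
   prescribed, whereas independence of the box on [D] is a property of the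
   weight of the curve. *)
Lemma leads_generate (w : 'X_{1..2} -> nat) f1 f2 :
    {morph w : u v / (u + v)%MM >-> (u + v)%N} ->
    in_ideal D f1 -> in_ideal D f2 ->
    strict_lead w f1 (xymon r.+1 0) -> strict_lead w f2 (xymon 0 s.+1) ->
  is_intersection D f1 f2.
Proof.
move=> wD D1 D2 l1 l2 g; split=> [Dg|[a [b ->]]]; last exact: in_ideal_comb.
pose N := (\sum_(u <- msupp g) w u).+1.
have [|g' [a [b e]] ng] := box_reduction wD l1 l2 (N := N) (g := g).
  by move=> u gu; rewrite ltnS (big_rem u) //= leq_addr.
suff g0 : g' = 0 by exists a, b; rewrite -e g0 subr0.
have Dg' : in_ideal D g'.
  by rewrite -[g'](subKr g) e; apply: in_idealB => //; exact: in_ideal_comb.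
apply/eqP; apply: contraT => g'0.
have [|u /ng ubox lg'] := strict_lead_exists g'0 (q := q).
  by move=> u /ng; lia.
by have := no_lead_box no_lead Dg' lg'; lia.
Qed.

End NoLead.

Section Leads.
Variables (D : {set hermpt F q}) (w : 'X_{1..2} -> nat) (f1 f2 : {mpoly F[2]}).
Variables i j : nat.
Hypothesis wD : {morph w : u v / (u + v)%MM >-> (u + v)%N}.
Hypothesis lead1 : strict_lead w f1 (xymon i 0).
Hypothesis lead2 : strict_lead w f2 (xymon 0 j).

Lemma intersection_card : is_intersection D f1 f2 -> (i * j <= #|D|)%N.
Proof.
move=> DI; rewrite leqNgt; apply/negP=> ltD.
have [|g [g0 gl /DI[a [b eg]]]] := @vanishing_combination F q D _ (rect_uniq i 0 j).
  by rewrite size_rect.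
case/eqP: g0; apply: (coprime_leads wD lead1 lead2 eg) => u /gl.
by rewrite mem_rect => /and3P[-> _ ->].
Qed.

Hypotheses (D1 : in_ideal D f1) (D2 : in_ideal D f2).

Lemma pairing_box (c : {ffun hermpt F q -> F}) N g : word_support c \subset D ->
    (forall u, u \in msupp g -> w u < N)%N ->
    (forall u, u \in rect i 0 j -> (w u < N)%N -> pairing c 'X_[u] = 0) ->
  pairing c g = 0.
Proof.
move=> sD lg c0; have [g' [a [b e]] ng] := box_reduction wD lead1 lead2 lg.
have /eqP := pairing_ideal sD (in_ideal_comb a b D1 D2).
rewrite -e pairingB subr_eq0 => /eqP->; rewrite pairingE big_seq big1 // => u /ng.
by case/and3P=> ui uj uN; rewrite c0 ?mulr0 // mem_rect ui.
Qed.

(** Otherwise a nonzero word on [D] would be orthogonal to the box, hence to all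
   polynomials. *)
Lemma leads_card : (#|D| <= i * j)%N.
Proof.
rewrite leqNgt -(size_rect i 0 j); apply/negP=> /orthogonal_word[c [c0 sD cbox]].
have [u /eqP[]] := pairing_neq0 c0.
apply: (pairing_box (N := (w u).+1) sD) => [v|v /cbox //].
by rewrite msuppX inE => /eqP->.
Qed.

(** Polynomials of weight at most [m] reduce to combinations of the monomials of
   the box other than its corner, which are fewer than the points of [D]. *)
Lemma leads_codeword m : (0 < i)%N -> (0 < j)%N -> (i * j <= #|D|)%N ->
    (forall u, weight q u <= m -> w u < w (xymon i.-1 j.-1))%N ->
  exists c, [/\ c != [ffun=> 0], word_support c \subset D & hermitian_code m c].
Proof.
move=> i_gt0 j_gt0 geD low; pose corner := xymon i.-1 j.-1.
have corner_in : corner \in rect i 0 j by rewrite mem_rect !xymonE; lia.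
have [|c [c0 sD cl]] := @orthogonal_word F q D (rem corner (rect i 0 j)).
  by rewrite size_rem // size_rect; apply: leq_trans geD; rewrite prednK ?muln_gt0 ?i_gt0.
exists c; split=> //; apply/hermitian_codeP=> u /low lu.
apply: (pairing_box (N := w corner) sD) => [v|v vbox lv].
  by rewrite msuppX inE => /eqP->.
apply: cl; rewrite mem_rem_uniq ?rect_uniq // inE vbox andbT.
by apply: contraTneq lv => ->; rewrite ltnn.
Qed.

End Leads.
End Boxes.

(** * Degree reverse lexicographic leading monomials and weights *)

(** The Hermitian polynomial has two monomials of top weight, [x^(q+1)] and
   [y^q].  This refinement of the weight makes [y^q] the leading one, while for
   [N] large it orders monomials of different weights as before. *)
Definition refined_weight (q N : nat) (u : 'X_{1..2}) : nat :=
  (weight q u * N + u iy)%N.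

Lemma refined_weightD q N :
  {morph refined_weight q N : u v / (u + v)%MM >-> (u + v)%N}.
Proof. by move=> u v; rewrite /refined_weight weightD mnmDE; lia. Qed.

Section LeadingMonomialsComparison.
Variables (F : finFieldType) (q : nat).
Implicit Types f : {mpoly F[2]}.

Lemma herm_lead N : (1 < q)%N -> (0 < N)%N ->
  strict_lead (refined_weight q N) (herm F q) (xymon 0 q).
Proof.
move=> q_gt1 N_gt0.
have hX : herm F q = 'X_[xymon q.+1 0] - 'X_[xymon 0 q] - 'X_[xymon 0 1].
  by rewrite /herm !mpolyXn /xymon !mulm0n !add0m addm0 mulm1n.
have xyE a b c d : (xymon a b == xymon c d) = (a == c) && (b == d).
  apply/eqP/andP=> [e|[/eqP-> /eqP->] //].
  by split; apply/eqP; [rewrite -(xymonx a b) e xymonx | rewrite -(xymony a b) e xymony].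
split.
  rewrite hX !mcoeffB !mcoeffX !xyE !eqxx /=.
  by rewrite (_ : (1 == q)%N = false) ?subr0 ?sub0r ?oppr_eq0 ?oner_eq0 //; lia.
move=> v; rewrite mcoeff_msupp hX !mcoeffB !mcoeffX.
have [<- _ _|_] := eqVneq (xymon q.+1 0) v.
  by rewrite /refined_weight !weight_xymon !xymonE; nia.
have [<- _ /eqP //|_] := eqVneq (xymon 0 q) v.
have [<- _ _|_] := eqVneq (xymon 0 1) v; last by rewrite !subr0 eqxx.
have : (q.+1 * N <= q * (q.+1 * N))%N by rewrite leq_pmull // ltnW.
by rewrite /refined_weight !weight_xymon !xymonE; lia.
Qed.

Lemma is_LM_lead_x f i : is_LM f (xymon i 0) -> (i <= q)%N ->
  strict_lead (weight q) f (xymon i 0).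
Proof.
move=> [fi lf] le_iq; split; first by rewrite -mcoeff_msupp.
move=> v fv ne; have := lf v fv ne.
rewrite /degrevlex_lt !mdeg2 !xymonE weight_xymon /weight.
by move=> /orP[lt|]; nia.
Qed.

Lemma is_LM_refined_lead_x f i N : is_LM f (xymon i 0) -> (i < q)%N -> (q <= N)%N ->
  strict_lead (refined_weight q N) f (xymon i 0).
Proof.
move=> [fi lf] lt_iq le_qN; split; first by rewrite -mcoeff_msupp.
move=> v fv ne; have := lf v fv ne.
rewrite /degrevlex_lt !mdeg2 /refined_weight weight_xymon !xymonE /weight.
move=> /orP[lt|]; last by lia.
have le1 : (v ix * q + v iy * q.+1 + 1 <= i * q)%N by nia.
have : ((v ix * q + v iy * q.+1 + 1) * N <= i * q * N)%N by rewrite leq_mul2r le1 orbT.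
by lia.
Qed.

Lemma is_LM_lead_y f j : is_LM f (xymon 0 j) ->
  strict_lead (weight q) f (xymon 0 j).
Proof.
move=> [fi lf]; split; first by rewrite -mcoeff_msupp.
move=> v fv ne; have := lf v fv ne.
rewrite /degrevlex_lt !mdeg2 !xymonE weight_xymon /weight.
by move=> /orP[lt|]; nia.
Qed.

Lemma lead_is_LM_x f i : strict_lead (weight q) f (xymon i 0) ->
  is_LM f (xymon i 0).
Proof.
move=> [fi lf]; split; first by rewrite mcoeff_msupp.
move=> v fv ne; have := lf v fv ne.
rewrite /degrevlex_lt !mdeg2 !xymonE weight_xymon /weight.
by move=> lt; apply/orP; left; nia.
Qed.

Lemma lead_is_LM_y f j : (j < q)%N -> strict_lead (weight q) f (xymon 0 j) ->
  is_LM f (xymon 0 j).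
Proof.
move=> lt_jq [fi lf]; split; first by rewrite mcoeff_msupp.
move=> v fv ne; have := lf v fv ne.
rewrite /degrevlex_lt !mdeg2 !xymonE weight_xymon /weight.
move=> lt; have le : (v ix + v iy <= j)%N by nia.
by nia.
Qed.

End LeadingMonomialsComparison.

(** * Vertical lines *)

Lemma prime_power_gt1 p k q : prime p -> (0 < k)%N -> q = (p ^ k)%N -> (1 < q)%N.
Proof.
move=> p_pr k_gt0 ->; rewrite -(prednK k_gt0) expnS (leq_trans (prime_gt1 p_pr)) //.
by rewrite leq_pmulr // expn_gt0 prime_gt0.
Qed.

(** The map [y |-> y^q + y] has values in the solutions of [z^q = z], of which
   there are at most [q]; its fibres also have at most [q] elements.  Since
   the field has [q^2] elements, every fibre over such a solution is full. *)
Lemma trace_fibre (p k q : nat) (F : finFieldType) (t : F) :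
    prime p -> (0 < k)%N -> q = (p ^ k)%N -> #|F| = (q ^ 2)%N -> t ^+ q = t ->
  #|[set y : F | y ^+ q + y == t]| = q.
Proof.
move=> p_pr k_gt0 q_def cardF tq.
have q_gt1 := prime_power_gt1 p_pr k_gt0 q_def.
have charF : p \in [pchar F].
  by apply: (@card_finPcharP F p (k * 2)); rewrite // cardF q_def expnM.
have q_char : [pchar F].-nat q.
  by rewrite q_def pnatX (eq_pnat _ (pcharf_eq charF)) pnat_id.
have count_roots (f : {poly F}) : size f = q.+1 -> (#|[set y | root f y]| <= q)%N.
  move=> sf; have f0 : f != 0 by rewrite -size_poly_eq0 sf.
  rewrite cardE -ltnS -sf; apply: max_poly_roots => //; last exact: enum_uniq.
  by apply/allP=> y; rewrite mem_enum inE.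
pose fibre z := [set y : F | y ^+ q + y == z]; rewrite -/(fibre t).
have fibre_le z : (#|fibre z| <= q)%N.
  have := count_roots ('X^q + ('X - z%:P)).
  rewrite size_polyDl size_polyXn ?size_XsubC //.
  move=> /(_ erefl); congr (_ <= _)%N; apply: eq_card => y.
  by rewrite !inE rootE !hornerE ?addrA subr_eq0.
pose T := [set z : F | z ^+ q == z].
have T_le : (#|T| <= q)%N.
  have := count_roots ('X^q - 'X).
  rewrite size_polyDl size_polyXn ?size_polyN ?size_polyX //.
  move=> /(_ erefl); congr (_ <= _)%N; apply: eq_card => y.
  by rewrite !inE rootE !hornerE subr_eq0.
have trT y : y ^+ q + y \in T.
  by rewrite inE exprDn_pchar // -exprM mulnn -cardF expf_card addrC.
have tT : t \in T by rewrite inE tq.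
have total : (q * q = \sum_(z in T) #|fibre z|)%N.
  rewrite mulnn -cardF -sum1_card (partition_big (fun y => y ^+ q + y) (mem T)) //=.
  apply: eq_bigr => z _; rewrite -sum1_card; apply: eq_bigl => y; by rewrite inE.
apply/eqP; rewrite eqn_leq fibre_le /= leqNgt; apply/negP=> lt_fq.
have : (\sum_(z in T) #|fibre z| < #|T| * q)%N.
  rewrite (bigD1 t) //= (cardsD1 t T) tT mulSn -addSn leq_add //.
  rewrite -sum_nat_const; rewrite [leqRHS](eq_bigl (fun z => (z \in T) && (z != t))).
    by apply: leq_sum.
  by move=> z; rewrite !inE andbC.
by rewrite -total ltn_pmul2r ?(ltnW q_gt1) // ltnNge T_le.
Qed.

Section VerticalLines.
Variables (F : finFieldType) (w : 'X_{1..2} -> nat).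
Hypothesis wD : {morph w : u v / (u + v)%MM >-> (u + v)%N}.

Lemma strict_leadM (f g : {mpoly F[2]}) u v :
  strict_lead w f u -> strict_lead w g v -> strict_lead w (f * g) (u + v)%MM.
Proof.
move=> lf lg; split.
  rewrite (mcoeff_lead_mul wD lg) => [|t]; last exact: (strict_lead_le lf).
  by rewrite mulf_neq0 ?lf.1 ?lg.1.
move=> t /msuppM_le/allpairsP[[u' v'] /= [fu' gv' ->]] ne; rewrite !wD.
have := (strict_lead_le lf fu', strict_lead_le lg gv') => -[le1 le2].
have [eu|neu] := eqVneq u' u; last by have := lf.2 _ fu' neu; lia.
have [ev|nev] := eqVneq v' v; last by have := lg.2 _ gv' nev; lia.
by rewrite eu ev eqxx in ne.
Qed.

Lemma vertical_lines_lead (l : seq F) : (0 < w (xymon 1 0))%N ->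
  strict_lead w (\prod_(a <- l) ('X_ix - a%:MP)) (xymon (size l) 0).
Proof.
move=> wx; have w0 : w 0%MM = 0%N.
  by have := wD 0%MM 0%MM; rewrite add0m; lia.
elim: l => [|a l IH].
  rewrite big_nil (_ : xymon _ _ = 0%MM); last by apply: monP; rewrite xymonE mnm0E.
  split; first by rewrite mcoeff1 eqxx oner_neq0.
  by move=> v; rewrite msupp1 inE => ->.
rewrite big_cons (_ : xymon _ _ = xymon 1 0 + xymon (size l) 0)%MM; last first.
  by apply: monP; rewrite addxyE !xymonE.
apply: strict_leadM IH.
have x10 : (xymon 1 0 == 0%MM) = false.
  by apply/eqP=> /mnmP/(_ ix); rewrite xymonE mnm0E.
have -> : 'X_ix = 'X_[xymon 1 0] :> {mpoly F[2]}.
  by congr 'X_[_]; apply: monP; rewrite xymonE mnm1E.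
split; first by rewrite mcoeffB mcoeffX mcoeffC x10 eqxx mulr0 subr0 oner_neq0.
move=> v; rewrite mcoeff_msupp mcoeffB mcoeffX mcoeffC.
have [<- _ /eqP //|nex] := eqVneq (xymon 1 0) v.
by have [-> _ _|ne0] := eqVneq v 0%MM; [rewrite w0 | rewrite mulr0 subr0 eqxx].
Qed.

End VerticalLines.

(** These points show that codewords of weight at most [mu q] exist. *)
Lemma vertical_lines (p k q : nat) (F : finFieldType) (w : 'X_{1..2} -> nat) mu :
    prime p -> (0 < k)%N -> q = (p ^ k)%N -> #|F| = (q ^ 2)%N -> (mu <= q)%N ->
    {morph w : u v / (u + v)%MM >-> (u + v)%N} -> (0 < w (xymon 1 0))%N ->
  exists (D : {set hermpt F q}) (f : {mpoly F[2]}),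
    [/\ in_ideal D f, strict_lead w f (xymon mu 0) & (mu * q <= #|D|)%N].
Proof.
move=> p_pr k_gt0 q_def cardF le_mu wD wx; pose l := take mu (enum F).
have size_l : size l = mu.
  by rewrite size_takel // -cardE cardF; nia.
pose D := [set P : hermpt F q | (val P).1 \in l].
exists D, (\prod_(a <- l) ('X_ix - a%:MP)); split.
- move=> P; rewrite inE => Pl; rewrite /evalpt rmorph_prod (big_rem _ Pl) /=.
  by rewrite mevalB mevalXU mevalC /= subrr mul0r.
- by rewrite -[in xymon _ _]size_l; exact: vertical_lines_lead.
pose S := [set z : F * F | (z.1 \in l) && (z.2 ^+ q + z.2 == z.1 ^+ q.+1)].
have -> : #|D| = #|S|.
  rewrite -(card_imset _ val_inj); apply: eq_card => z; apply/imsetP/idP.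
    case=> P; rewrite inE => Pl ->; rewrite inE Pl.
    by rewrite -evalpt_herm; exact: (valP P).
  rewrite inE => /andP[zl ez].
  have zP : evalpt (herm F q) z == 0 by rewrite evalpt_herm.
  by exists (Sub z zP : hermpt F q); rewrite ?inE SubK.
rewrite -sum1_card (eq_bigl (fun z : F * F =>
  (z.1 \in l) && (z.2 ^+ q + z.2 == z.1 ^+ q.+1))); last by move=> z; rewrite inE.
rewrite -(pair_big_dep (mem l) (fun a b => b ^+ q + b == a ^+ q.+1) (fun _ _ => 1%N)) /=.
rewrite (eq_bigr (fun=> q)) => [|a _]; last first.
  rewrite -[RHS](@trace_fibre p k q F (a ^+ q.+1)) // -?exprM.
    by rewrite -sum1_card; apply: eq_bigl => b; rewrite inE.
  by rewrite mulSn mulnn exprD -cardF expf_card -exprSr.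
rewrite sum_nat_const (card_uniqP _) ?size_l //.
by rewrite take_uniq // enum_uniq.
Qed.

(** * The gaps of the semigroup *)

(** From the conductor [q^2 - q] on, every number is a weight; the weight of
   [x^(q+1)] is also that of [y^q], which brings the exponent of [x] below
   [q + 1]. *)
Lemma in_Lambda_B_range q l : (1 < q)%N -> (q ^ 2 - q <= l)%N ->
  (l < (2 * q - 2) * q)%N -> in_Lambda_B q l.
Proof.
move=> q_gt1 lo hi; set k := (l %/ q)%N; set i := (l %% q)%N.
have el : l = (k * q + i)%N by exact: divn_eq.
have lt_iq : (i < q)%N by rewrite ltn_mod ltnW.
have lt_k : (k < 2 * q - 2)%N by rewrite ltn_divLR // ltnW.
have ge_k : (q - 1 <= k)%N by rewrite leq_divRL ?(ltnW q_gt1) // mulnBl mul1n mulnn.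
have [le|gt] := leqP (k - i) q.
  exists (xymon (k - i) i); last by rewrite weight_xymon el; nia.
  by rewrite /in_B !xymonE; apply/orP; left; rewrite le /=; nia.
exists (xymon (k - i - q.+1) (i + q)); last first.
  have [t et] : exists t, k = (t + i + q.+1)%N by exists (k - i - q.+1)%N; lia.
  by rewrite weight_xymon el et (_ : t + i + q.+1 - i - q.+1 = t)%N; [ring | lia].
by rewrite /in_B !xymonE; apply/orP; left; apply/andP; split; [lia | nia].
Qed.

(** For [m] in the given range [m + 1] lies in [Lambda_B], so [m < mt] means that
   [delta m] is missing from the semigroup.  Its elements below [q^2 - q] are
   the numbers [k q + i] with [i <= k]; hence the gaps are the open intervals from
   [(mu-1)(q+1)] to [mu q], and [delta mt] is the upper end of the gap.  The
   last two inequalities place [m] relative to the weights of the corners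
   [x^(q-1) y^(mu-1)] and [x^(mu-1) y^(q-1)] of the two boxes. *)
Lemma gap_location q m mt : (1 < q)%N ->
    (q ^ 2 - q - 1 <= m)%N -> (m <= 2 * q ^ 2 - 2 * q - 3)%N ->
    is_mtilde q m mt -> (m < mt)%N ->
  exists mu, [/\ (0 < mu < q)%N, delta q mt = (mu * q)%N,
    ((q - 1) * q + (mu - 1) * q.+1 <= m.+1)%N
    & (m < (mu - 1) * q + (q - 1) * q.+1)%N].
Proof.
move=> q_gt1 m_ge m_le [_ _ mt_semi mt_min] lt_m.
have q2 : (2 * q <= q ^ 2)%N by rewrite -mulnn leq_mul2r q_gt1 orbT.
have [d ed] : exists d, (m + q + 2 = d + q ^ 2)%N.
  by exists (m + q + 2 - q ^ 2)%N; lia.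
have deltaE n e : (n + q + 2 = e + q ^ 2)%N -> delta q n = e.
  by rewrite /delta => ->; rewrite addnK.
have Lam n : (m <= n)%N -> (n.+1 < (2 * q - 2) * q)%N -> in_Lambda_B q n.+1.
  by move=> le lt; apply: in_Lambda_B_range => //; lia.
have d_gap : ~ in_semigroup q d.
  move=> d_semi; have : (mt <= m)%N.
    apply: mt_min => //; last by rewrite (deltaE m d).
    by apply: Lam => //; rewrite mulnBl -mulnA mulnn; lia.
  by rewrite leqNgt lt_m.
set k := (d %/ q)%N; set i := (d %% q)%N.
have edk : d = (k * q + i)%N by exact: divn_eq.
have lt_iq : (i < q)%N by rewrite ltn_mod ltnW.
have lt_ki : (k < i)%N.
  rewrite ltnNge; apply/negP=> le; apply: d_gap; exists (k - i)%N, i.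
  have : (i * q <= k * q)%N by rewrite leq_mul2r le orbT.
  by rewrite edk mulnBl mulnS; lia.
have kq : (k.+1 < q)%N by lia.
have kq' : (k.+1 * q <= (q - 1) * q)%N by rewrite leq_mul2r; lia.
exists k.+1; split=> //; first 1 last.
- by rewrite [(k.+1 - 1)%N]subn1 /= mulnBl mul1n mulnn mulnS; lia.
- by rewrite [(k.+1 - 1)%N]subn1 /= mulnBl mul1n [(q * q.+1)%N]mulnS mulnn; lia.
pose n := (k.+1 * q + q ^ 2 - q - 2)%N.
have en : (n + q + 2 = k.+1 * q + q ^ 2)%N by rewrite /n mulSn; lia.
have le_mn : (m <= n)%N by rewrite mulSn in en; lia.
have le_mt : (mt <= n)%N.
  apply: mt_min => //.
    apply: Lam => //; rewrite mulnBl mul1n mulnn in kq' *.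
    by rewrite mulnBl -mulnA mulnn; lia.
  by rewrite (deltaE _ _ en); exists k.+1, 0%N; rewrite mul0n addn0.
have [e ee] : exists e, (mt + q + 2 = e + q ^ 2)%N.
  by exists (mt + q + 2 - q ^ 2)%N; lia.
rewrite (deltaE _ _ ee) in mt_semi *; case: mt_semi => a [b eab].
have le_e : (e <= k.+1 * q)%N by lia.
have lt_de : (d < e)%N by lia.
apply/eqP; rewrite eqn_leq le_e /= leqNgt; apply/negP=> lt_e.
have e2 : e = ((a + b) * q + b)%N by rewrite eab; ring.
have [le|lt] := leqP (a + b) k.
  have : ((a + b) * q <= k * q)%N by rewrite leq_mul2r le orbT.
  by lia.
have : (k.+1 * q <= (a + b) * q)%N by rewrite leq_mul2r lt orbT.
by lia.
Qed.

(** * Codewords of minimum weight *)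

Section MinimumWeight.
Variables (F : finFieldType) (q m mu : nat).
Hypotheses (q_gt1 : (1 < q)%N) (mu_bounds : (0 < mu < q)%N).
Hypothesis m_lo : ((q - 1) * q + (mu - 1) * q.+1 <= m.+1)%N.
Hypothesis m_hi : (m < (mu - 1) * q + (q - 1) * q.+1)%N.
Implicit Types (c : {ffun hermpt F q -> F}) (D : {set hermpt F q}).
Implicit Types (f g : {mpoly F[2]}).

(* Large enough for the tie-breaking [y]-exponents of monomials of weight at
   most [m], and of the monomials of degree less than [mu], to be harmless. *)
Let N := (m + q).+1.
Let w := refined_weight q N.

Let wD : {morph w : u v / (u + v)%MM >-> (u + v)%N}.
Proof. exact: refined_weightD. Qed.

Lemma weight_lower_bound c : hermitian_code m c -> c != [ffun=> 0] ->
  (mu * q <= #|word_support c|)%N.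
Proof.
move=> Cc c0; have [r [s [s_lt lt_m no_lead]]] := leading_weight q_gt1 Cc c0.
have [ge _] := order_bound_min mu_bounds s_lt (leq_trans m_lo lt_m).
exact: leq_trans ge (order_bound no_lead s_lt).
Qed.

(** Equality in the order bound fixes the leading weight, hence the box; the
   missing generators are found just outside it. *)
Lemma low_weight_complete_intersection c : hermitian_code m c ->
    c != [ffun=> 0] -> (#|word_support c| <= mu * q)%N ->
  (exists2 f, is_LM f (xymon mu 0) & is_intersection (word_support c) (herm F q) f)
  \/ (m.+1 = (q - 1) * q + (mu - 1) * q.+1)%N /\
     exists f1 f2, [/\ is_LM f1 (xymon q 0), is_LM f2 (xymon 0 mu)
       & is_intersection (word_support c) f1 f2].
Proof.
move=> Cc c0 le_c; have [r [s [s_lt lt_m no_lead]]] := leading_weight q_gt1 Cc c0.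
have le_rs := leq_trans (order_bound no_lead s_lt) le_c.
have [[er es]|[er es]] :=
  (order_bound_min mu_bounds s_lt (leq_trans m_lo lt_m)).2 le_rs.
- left; have er1 : r.+1 = mu by lia.
  have es1 : s.+1 = q by lia.
  have [|||f Df lf] := new_lead s_lt no_lead (u0 := xymon mu 0).
  + by rewrite er1 es1.
  + by rewrite xymonE; lia.
  + by rewrite !xymonE -er1 ltnn.
  have LMf := lead_is_LM_x lf.
  exists f => //.
  have lw : strict_lead w f (xymon r.+1 0).
    by rewrite er1; apply: is_LM_refined_lead_x LMf _ _; rewrite /N; lia.
  have hw : strict_lead w (herm F q) (xymon 0 s.+1) by rewrite es1; exact: herm_lead.
  have DI := leads_generate s_lt no_lead wD Df (@herm_in_ideal F q _) lw hw.
  move=> g; split=> [/DI[a [b ->]]|[a [b ->]]].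
    by exists b, a; rewrite addrC.
  by apply/DI; exists b, a; rewrite addrC.
- right; have er1 : r.+1 = q by lia.
  have es1 : s.+1 = mu by lia.
  split; first by apply/eqP; rewrite eqn_leq m_lo andbT -er -es.
  have [|||f1 D1 l1] := new_lead s_lt no_lead (u0 := xymon q 0).
  + by rewrite er1 es1 mulnC.
  + by rewrite xymonE; lia.
  + by rewrite !xymonE -er1 ltnn.
  have [|||f2 D2 l2] := new_lead s_lt no_lead (u0 := xymon 0 mu).
  + by rewrite er1 es1 mulnC.
  + by rewrite xymonE; lia.
  + by rewrite !xymonE -es1 ltnn andbF.
  exists f1, f2; split; first exact: lead_is_LM_x l1.
    by apply: lead_is_LM_y l2; lia.
  by apply: (leads_generate s_lt no_lead (@weightD q) D1 D2); rewrite ?er1 ?es1.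
Qed.

Lemma refined_weight_corner u : (weight q u <= m)%N ->
  (w u < w (xymon mu.-1 q.-1))%N.
Proof.
move=> le_um; rewrite /w /refined_weight weight_xymon xymonE.
have uy : (u iy <= weight q u)%N by rewrite /weight; nia.
have lt : (m.+1 * N <= (mu.-1 * q + q.-1 * q.+1) * N)%N.
  by rewrite leq_mul2r -!subn1 m_hi orbT.
apply: leq_trans (leq_trans lt (leq_addr _ _)).
by rewrite mulSn [(N + _)%N]addnC -addnS leq_add ?leq_mul2r ?le_um ?orbT // /N; lia.
Qed.

Lemma herm_intersection_card D f : is_LM f (xymon mu 0) ->
  is_intersection D (herm F q) f -> (mu * q = #|D|)%N /\ strict_lead w f (xymon mu 0).
Proof.
move=> LMf DI.
have DI' : is_intersection D f (herm F q).
  by move=> g; split=> [/DI[a [b ->]]|[a [b ->]]];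
     [exists b, a | apply/DI; exists b, a]; rewrite addrC.
have lf : strict_lead w f (xymon mu 0).
  by apply: is_LM_refined_lead_x LMf _ _; rewrite /N; lia.
have lh : strict_lead w (herm F q) (xymon 0 q) by exact: herm_lead.
have Df : in_ideal D f by apply/DI; exists 0, 1; rewrite mul0r mul1r add0r.
split=> //; apply/eqP; rewrite eqn_leq (intersection_card wD lf lh DI').
exact: leads_card wD lf lh Df (@herm_in_ideal F q _).
Qed.

Lemma herm_codeword D f : in_ideal D f -> strict_lead w f (xymon mu 0) ->
    (mu * q <= #|D|)%N ->
  exists c, [/\ c != [ffun=> 0], word_support c \subset D & hermitian_code m c].
Proof.
move=> Df lf geD; have lh : strict_lead w (herm F q) (xymon 0 q) by exact: herm_lead.
apply: (leads_codeword wD lf lh Df (@herm_in_ideal F q _)) => //; try lia.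
exact: refined_weight_corner.
Qed.

(** The lower bound on weights leaves no room for a smaller support. *)
Lemma codeword_support_full D c : (#|D| <= mu * q)%N -> c != [ffun=> 0] ->
    word_support c \subset D -> hermitian_code m c ->
  exists2 c, min_weight_codeword (hermitian_code m) c & word_support c = D.
Proof.
move=> leD c0 sD Cc; have ge := weight_lower_bound Cc c0; exists c.
  split=> // c' Cc' c'0; apply: leq_trans (weight_lower_bound Cc' c'0).
  exact: leq_trans (subset_leq_card sD) leD.
by apply/eqP; rewrite eqEcard sD (leq_trans leD).
Qed.

(** Here the corner of the box has weight [m + 1], the least that escapes [m]. *)
Lemma intersection_codeword D f1 f2 : (m.+1 = (q - 1) * q + (mu - 1) * q.+1)%N ->
    is_LM f1 (xymon q 0) -> is_LM f2 (xymon 0 mu) -> is_intersection D f1 f2 ->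
  exists2 c, min_weight_codeword (hermitian_code m) c & word_support c = D.
Proof.
move=> em /is_LM_lead_x/(_ (leqnn q)) l1 /(is_LM_lead_y q) l2 DI.
have wqD := @weightD q.
have D1 : in_ideal D f1 by apply/DI; exists 1, 0; rewrite mul0r mul1r addr0.
have D2 : in_ideal D f2 by apply/DI; exists 0, 1; rewrite mul0r mul1r add0r.
have [|||u le_u|c [c0 sD Cc]] := leads_codeword wqD l1 l2 D1 D2 (m := m).
- by lia.
- by lia.
- exact: intersection_card wqD l1 l2 DI.
- by rewrite weight_xymon -!subn1 -em ltnS.
apply: codeword_support_full c0 sD Cc.
by rewrite mulnC; exact: leads_card wqD l1 l2 D1 D2.
Qed.

(** The set [D0], for which [vertical_lines] is meant, supplies a codeword of
   weight at most [mu q], so that a codeword of minimum weight has at most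
   [mu q] points in its support. *)
Lemma min_weight_support D :
    (exists (D0 : {set hermpt F q}) (f0 : {mpoly F[2]}),
      [/\ in_ideal D0 f0, strict_lead w f0 (xymon mu 0) & (mu * q <= #|D0|)%N]) ->
  (exists2 c, min_weight_codeword (hermitian_code m) c & word_support c = D)
  <->
  (exists2 f, is_LM f (xymon mu 0) & is_intersection D (herm F q) f)
  \/ (m.+1 = (q - 1) * q + (mu - 1) * q.+1)%N /\
     exists f1 f2, [/\ is_LM f1 (xymon q 0), is_LM f2 (xymon 0 mu)
       & is_intersection D f1 f2].
Proof.
move=> [D0 [f0 [Df0 lf0 geD0]]]; split.
  move=> [c [Cc c0 minc] <-].
  apply: low_weight_complete_intersection => //.
  have [c' [c'0 sD0 Cc']] := herm_codeword Df0 lf0 geD0.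
  apply: leq_trans (minc c' Cc' c'0) (leq_trans (subset_leq_card sD0) _).
  exact: leads_card wD lf0 (herm_lead F q_gt1 (ltn0Sn _)) Df0 (@herm_in_ideal F q _).
case=> [[f LMf DI]|[em [f1 [f2 [l1 l2 DI]]]]]; last exact: intersection_codeword DI.
have [cardD lf] := herm_intersection_card LMf DI.
have Df : in_ideal D f by apply/DI; exists 0, 1; rewrite mul0r mul1r add0r.
have [|c [c0 sD Cc]] := herm_codeword Df lf; first by rewrite cardD.
by apply: codeword_support_full c0 sD Cc; rewrite cardD.
Qed.

End MinimumWeight.

Theorem theorem5p4 (p k q : nat) (p_prime : prime p) (k_gt0 : (0 < k)%N)
    (q_def : q = (p ^ k)%N) (F : finFieldType) (cardF : #|F| = (q ^ 2)%N)
    (m mt : nat) (m_ge : (q ^ 2 - q - 1 <= m)%N)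
    (m_le : (m <= 2 * q ^ 2 - 2 * q - 3)%N)
    (mtP : is_mtilde q m mt) (m_lt : (m < mt)%N) :
  exists mu : nat,
    [/\ delta q mt = (mu * q)%N, (mu * q)%N = weight q (xymon mu 0)
      & forall D : {set hermpt F q},
        (exists2 c, min_weight_codeword (hermitian_code m) c
                  & word_support c = D)
        <->
        (exists2 f : {mpoly F[2]}, is_LM f (xymon mu 0)
                  & is_intersection D (herm F q) f)
        \/
        [/\ m = ((mu + q - 3) * (q + 1) + 1)%N, (1 <= mu <= q - 1)%N
          & exists f1 f2 : {mpoly F[2]},
              [/\ is_LM f1 (xymon q 0), is_LM f2 (xymon 0 mu)
                & is_intersection D f1 f2]]].
Proof.
have q_gt1 := prime_power_gt1 p_prime k_gt0 q_def.
have [mu [mu_bounds emt m_lo m_hi]] := gap_location q_gt1 m_ge m_le mtP m_lt.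
exists mu; split=> //; first by rewrite weight_xymon addn0.
move=> D; have := @min_weight_support F q m mu q_gt1 mu_bounds m_lo m_hi D.
have em : (m.+1 = (q - 1) * q + (mu - 1) * q.+1)%N <->
          (m = (mu + q - 3) * (q + 1) + 1)%N.
  have [a ea] : exists a, q = a.+2 by exists (q - 2)%N; lia.
  have [n en] : exists n, mu = n.+1 by exists (mu - 1)%N; lia.
  by rewrite ea en !subn1 /= (_ : n.+1 + a.+2 - 3 = n + a)%N; [split; lia | lia].
case=> [|H1 H2].
  apply: (vertical_lines p_prime k_gt0 q_def cardF); first by lia.
    exact: refined_weightD.
  by rewrite /refined_weight weight_xymon; lia.
split=> [/H1[|[/em]]|]; [by left | by right; split=> //; lia |].
case=> [?|[/em ? _ ?]]; apply: H2; [by left | by right].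
Qed.
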